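(* Consider the system $$A_s\,\sigma^s(y)+\ldots+A_1\,\sigma(y)+A_0\,y=t^{-\nu}b$$ with $A_0,\ldots,A_s\in\mathbb{K}[t]^{m\times m}$, $b\in\mathbb{K}[t]^m$ and an integer $\nu\geq 0$. Let $\ell$ be the maximum of $\deg_t A_0,\ldots,\deg_t A_s$ and let $\kappa=\deg_t b$. For each $j$ let $A_{j\ell}\in\mathbb{K}^{m\times m}$ denote the coefficient matrix of $t^\ell$ in $A_j$. Assume that the system is $t$-head regular, that is, the polynomial $$\rho=\det\Bigl(\sum_{j=0}^s A_{j\ell}x^j\Bigr)\in\mathbb{K}[x]$$ is not identically zero. If $y\in\mathbb{K}[t]^m$ is a polynomial solution of the system of degree $n$, then 1. either $n\leq\kappa-\nu-\ell$, 2. or $q^n$ is a root of $\rho$. In particular, there are only finitely many candidates for $n$: the set of integers $n\geq 0$ satisfying 1 or 2 is finite.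
   Context: $\mathbb{K}$ is a field of characteristic $0$, $q\in\mathbb{K}\setminus\{0\}$ is not a root of unity, and $t$ is an indeterminate over $\mathbb{K}$. The $q$-shift $\sigma$ is the automorphism of the rational function field $\mathbb{K}(t)$ that fixes $\mathbb{K}$ elementwise and satisfies $\sigma(t)=qt$; it acts on column vectors in $\mathbb{K}(t)^m$ component-wise. The degree $\deg_t$ of a polynomial vector or matrix is the largest exponent of $t$ whose coefficient vector or matrix is nonzero, with $\deg_t 0=-\infty$. A solution $y$ of degree $n$ is a nonzero solution $y=y_nt^n+\ldots+y_1t+y_0$ with $y_0,\ldots,y_n\in\mathbb{K}^m$ and $y_n\neq 0$. Let $\mathbb{K}(t)[\sigma]$ be the skew polynomial ring of operators in $\sigma$ with coefficients in $\mathbb{K}(t)$ written on the left, with $\sigma f=\sigma(f)\sigma$ for $f\in\mathbb{K}(t)$. Standing assumption: the matrix $A_s\sigma^s+\ldots+A_0$ has full (left row) rank over $\mathbb{K}(t)[\sigma]$, i.e. its rows are left linearly independent over $\mathbb{K}(t)[\sigma]$ (in particular not all $A_j$ are zero, so $\ell\geq 0$). *)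

(* Defs.v *)
From mathcomp Require Import all_boot all_order all_algebra.
From mathcomp Require Import constructive_ereal.

Set Implicit Arguments.
Unset Strict Implicit.
Unset Printing Implicit Defensive.

Import Order.TTheory GRing.Theory Num.Theory.
Local Open Scope ring_scope.

Notation "x %:F" := (@FracField.tofrac _ x) : ring_scope.
Notation ratfun K := {fraction {poly K}}.

Lemma fracE (R : idomainType) (f : {fraction R}) :
  f = (\n_(repr f))%:F / (\d_(repr f))%:F.
Proof.
have d0 : \d_(repr f) != 0 by exact: denom_ratioP.
unlock FracField.tofrac.
rewrite -[X in _ = _ * X]FracField.pi_inv -[RHS]FracField.pi_mul.
rewrite /FracField.mulf /FracField.invf !numden_Ratio ?oner_eq0 ?d0 //.
by rewrite mulr1 mul1r Ratio_numden reprK.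
Qed.

Lemma frac_ex (R : idomainType) (f : {fraction R}) :
  exists n d : R, d != 0 /\ f = n%:F / d%:F.
Proof.
exists \n_(repr f), \d_(repr f); split; first exact: denom_ratioP.
exact: fracE.
Qed.

Lemma frac_eqP (R : idomainType) (n d n' d' : R) : d != 0 -> d' != 0 ->
  n%:F / d%:F = n'%:F / d'%:F <-> n * d' = n' * d.
Proof.
move=> d0 d'0; have dF := d0; have d'F := d'0.
rewrite -tofrac_eq0 in dF; rewrite -tofrac_eq0 in d'F.
split=> /eqP; first by rewrite (eqr_div _ _ dF d'F) -!tofracM tofrac_eq => /eqP.
by move=> h; apply/eqP; rewrite (eqr_div _ _ dF d'F) -!tofracM tofrac_eq.
Qed.

Lemma frac_add (R : idomainType) (n d n' d' : R) : d != 0 -> d' != 0 ->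
  n%:F / d%:F + n'%:F / d'%:F = (n * d' + n' * d)%:F / (d * d')%:F.
Proof.
rewrite -tofrac_eq0 => d0; rewrite -tofrac_eq0 => d'0.
by rewrite (addf_div _ _ d0 d'0) -!tofracM -tofracD.
Qed.

Lemma frac_mul (R : idomainType) (n d n' d' : R) :
  n%:F / d%:F * (n'%:F / d'%:F) = (n * n')%:F / (d * d')%:F.
Proof. by rewrite mulf_div -!tofracM. Qed.

Section QShift.
Variables (K : fieldType) (q : K).

(* f(t) |-> f(qt): substitute qt in the chosen numerator and denominator of f.
   For q != 0 the value does not depend on that choice, see qshift_frac. *)
Definition qshift (f : ratfun K) : ratfun K :=
  (\n_(repr f) \Po (q *: 'X))%:F / (\d_(repr f) \Po (q *: 'X))%:F.

Hypothesis q0 : q != 0.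

Lemma comp_qX_eq0 (p : {poly K}) : (p \Po (q *: 'X) == 0) = (p == 0).
Proof. by rewrite comp_poly2_eq0 // size_scale ?size_polyX. Qed.

Lemma qshift_frac (n d : {poly K}) : d != 0 ->
  qshift (n%:F / d%:F) = (n \Po (q *: 'X))%:F / (d \Po (q *: 'X))%:F.
Proof.
move=> d0; rewrite /qshift; move: (fracE (n%:F / d%:F)).
have : \d_(repr (n%:F / d%:F)) != 0 by exact: denom_ratioP.
move: (\n_(repr _)) (\d_(repr _)) => n' d' d'0.
move/(frac_eqP _ _ d0 d'0) => e.
by apply/frac_eqP; rewrite ?comp_qX_eq0 // -!comp_polyM e.
Qed.

Lemma qshift_poly (p : {poly K}) : qshift p%:F = (p \Po (q *: 'X))%:F.
Proof.
have := qshift_frac p (oner_neq0 {poly K}).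
by rewrite comp_polyC tofrac1 !divr1.
Qed.

Lemma qshiftC (c : K) : qshift (c%:P)%:F = (c%:P)%:F.
Proof. by rewrite qshift_poly comp_polyC. Qed.

Lemma qshiftX : qshift 'X%:F = (q%:P)%:F * 'X%:F.
Proof. by rewrite qshift_poly comp_polyX -mul_polyC tofracM. Qed.

Lemma qshiftD : {morph qshift : f g / f + g}.
Proof.
move=> f g; have [n [d [d0 ->]]] := frac_ex f.
have [n' [d' [d'0 ->]]] := frac_ex g.
rewrite (frac_add _ _ d0 d'0) !qshift_frac ?mulf_neq0 //.
by rewrite frac_add ?comp_qX_eq0 // !comp_polyM -!comp_polyM -comp_polyD.
Qed.

Lemma qshiftM : {morph qshift : f g / f * g}.
Proof.
move=> f g; have [n [d [d0 ->]]] := frac_ex f.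
have [n' [d' [d'0 ->]]] := frac_ex g.
by rewrite frac_mul !qshift_frac ?mulf_neq0 // frac_mul !comp_polyM.
Qed.

End QShift.

Lemma qshiftK (K : fieldType) (q : K) : q != 0 ->
  cancel (qshift q) (qshift q^-1).
Proof.
move=> q0 f; have [n [d [d0 ->]]] := frac_ex f.
rewrite (qshift_frac q0 n d0) qshift_frac ?invr_eq0 ?comp_qX_eq0 // -!comp_polyA.
have -> : (q *: 'X) \Po (q^-1 *: 'X) = 'X :> {poly K}.
  by rewrite comp_polyZ comp_polyX scalerA divff // scale1r.
by rewrite !comp_polyXr.
Qed.

Lemma qshift_bij (K : fieldType) (q : K) : q != 0 -> bijective (qshift q).
Proof.
move=> q0; exists (qshift q^-1); first exact: qshiftK.
by rewrite -{2}[q]invrK; apply: qshiftK; rewrite invr_eq0.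
Qed.

(* The skew polynomial ring F[sigma]: p : {poly F} stands for the operator
   \sum_i p`_i sigma^i, multiplied according to sigma f = s(f) sigma. *)
Definition skew_mul (F : nzRingType) (s : F -> F) (p r : {poly F}) : {poly F} :=
  \sum_(i < size p) \sum_(j < size r) (p`_i * iter i s r`_j) *: 'X^(i + j).

Definition left_row_independent (F : nzRingType) (s : F -> F) (m n : nat)
    (M : 'M[{poly F}]_(m, n)) : Prop :=
  forall c : 'I_m -> {poly F},
    (forall k, \sum_(i < m) skew_mul s (c i) (M i k) = 0) -> forall i, c i = 0.

Section Systems.
Variable K : fieldType.

Definition coef_mx (m n : nat) (A : 'M[{poly K}]_(m, n)) (k : nat)
  : 'M[K]_(m, n) := map_mx (fun p : {poly K} => p`_k) A.

(* The bound on k only makes the range finite: by coef_mx_geq every nonzero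
   coefficient matrix is taken into account. *)
Definition deg_t (m n : nat) (A : 'M[{poly K}]_(m, n)) : \bar int :=
  \big[maxe/-oo%E]_(k < \max_(ij : 'I_m * 'I_n) size (A ij.1 ij.2)
                    | coef_mx A k != 0) (k%:Z)%:E.

Lemma coef_mx_geq (m n : nat) (A : 'M[{poly K}]_(m, n)) (k : nat) :
  (\max_(ij : 'I_m * 'I_n) size (A ij.1 ij.2) <= k)%N -> coef_mx A k = 0.
Proof.
move=> h; apply/matrixP => i j; rewrite !mxE nth_default //.
apply: leq_trans h.
exact: (leq_bigmax (F := fun ij : 'I_m * 'I_n => size (A ij.1 ij.2)) (i, j)).
Qed.

Lemma deg_t0 (m n : nat) : deg_t (0 : 'M_(m, n)) = -oo%E.
Proof.
rewrite /deg_t big1_idem ?maxxx // => k /eqP[].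
by apply/matrixP => i j; rewrite !mxE coef0.
Qed.

Lemma deg_tP (m n : nat) (A : 'M[{poly K}]_(m, n)) (d : nat) :
  deg_t A = (d%:Z)%:E <->
  coef_mx A d != 0 /\ forall k, (d < k)%N -> coef_mx A k = 0.
Proof.
rewrite /deg_t; set N := (\max_(ij : _ ) _)%N.
have small k : coef_mx A k != 0 -> (k < N)%N.
  by rewrite ltnNge; apply: contra => /coef_mx_geq->.
split=> [h|[cd hd]].
  have up k : coef_mx A k != 0 -> (k <= d)%N.
    move=> ck; rewrite -lez_nat -lee_fin -h.
    exact: (le_bigmax_cond _ (fun k : 'I_N => (k%:Z)%:E) (j := Ordinal (small k ck))).
  split=> [|k dk]; last first.
    by apply/eqP; apply: contraLR dk => /up; rewrite -leqNgt.
  suff : let x := deg_t A in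
      x = -oo%E \/ exists2 k, coef_mx A k != 0 & x = (k%:Z)%:E.
    by rewrite /= /deg_t h => -[|[k ck [->]]].
  apply: (big_ind (fun x => x = -oo%E \/
      exists2 k, coef_mx A k != 0 & x = (k%:Z)%:E)).
  - by left.
  - by move=> x y hx hy; rewrite maxEle; case: ifP.
  - by move=> k ck; right; exists k.
apply/le_anti/andP; split.
  apply: bigmax_le => [|k ck]; first exact: leNye.
  rewrite lee_fin lez_nat leqNgt; apply/negP => /hd ck0.
  by rewrite ck0 eqxx in ck.
exact: (le_bigmax_cond _ (fun k : 'I_N => (k%:Z)%:E) (j := Ordinal (small d cd))).
Qed.

Definition frac_mx (m n : nat) (A : 'M[{poly K}]_(m, n)) : 'M[ratfun K]_(m, n) :=
  map_mx (fun p : {poly K} => p%:F) A.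

(* The matrix A_s sigma^s + ... + A_0 over K(t)[sigma]. *)
Definition system_op (m s : nat) (A : 'I_s.+1 -> 'M[{poly K}]_m) :
    'M[{poly ratfun K}]_m :=
  \matrix_(i, k) \sum_(j < s.+1) (A j i k)%:F *: 'X^j.

Definition full_left_row_rank (q : K) (m s : nat) (A : 'I_s.+1 -> 'M[{poly K}]_m) : Prop :=
  left_row_independent (qshift q) (system_op A).

Definition is_solution (q : K) (m s : nat) (A : 'I_s.+1 -> 'M[{poly K}]_m)
    (nu : nat) (b y : 'cV[{poly K}]_m) : Prop :=
  \sum_(j < s.+1) frac_mx (A j) *m map_mx (iter j (qshift q)) (frac_mx y)
    = 'X%:F ^- nu *: frac_mx b.

Definition t_head_poly (m s l : nat) (A : 'I_s.+1 -> 'M[{poly K}]_m) : {poly K} :=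
  \det (\sum_(j < s.+1) 'X^j *: map_mx polyC (coef_mx (A j) l)).

End Systems.

(* Main.v *)
Require Import Defs.
From mathcomp Require Import all_boot all_order all_algebra.
From mathcomp Require Import boolp classical_sets cardinality constructive_ereal.
From mathcomp Require Import zify.
Set Implicit Arguments.
Unset Strict Implicit.
Unset Printing Implicit Defensive.

Import Order.TTheory GRing.Theory Num.Theory.
Local Open Scope ring_scope.

(* Comparing the coefficients of t^(nu + l + n) on both sides of the system
   multiplied by t^nu gives M(q^n) y_n = b_(nu + l + n), where
   M(x) = \sum_j A_(j l) x^j and \det M = rho. If the right-hand side is nonzero
   then nu + l + n <= kappa; otherwise y_n is a nonzero vector in the kernel of
   M(q^n), so q^n is a root of rho. Finiteness holds because n |-> q^n is
   injective. *)

Section Degree.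
Variables (K : fieldType) (m n : nat).
Implicit Types A : 'M[{poly K}]_(m, n).

Lemma deg_t_ge A k : coef_mx A k != 0 -> ((k%:Z)%:E <= deg_t A)%E.
Proof.
move=> ck; have kN : (k < \max_(ij : 'I_m * 'I_n) size (A ij.1 ij.2))%N.
  by rewrite ltnNge; apply: contra ck => /coef_mx_geq->.
exact: (le_bigmax_cond _ (fun k : 'I__ => (k%:Z)%:E) (j := Ordinal kN)).
Qed.

(** An upper bound on the degree is enough here, since a single [A j] may have degree below [l], or
    be zero. *)
Lemma coef_mx_gt_deg A d k :
  (deg_t A <= (d%:Z)%:E)%E -> (d < k)%N -> coef_mx A k = 0.
Proof.
move=> Ad; apply: contraTeq => /deg_t_ge /le_trans /(_ Ad).
by rewrite lee_fin lez_nat -leqNgt.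
Qed.

(** Degrees live in [\bar int], which contains [+oo]; excluding it leaves an integer or [-oo] when
    [deg_t b] is split into cases. *)
Lemma deg_t_pinfty A : deg_t A != +oo%E.
Proof. by rewrite lt_eqF //; apply: bigmax_lt => // k _; rewrite ltry. Qed.

Lemma coef_mx_sum (I : finType) (F : I -> 'M[{poly K}]_(m, n)) k :
  coef_mx (\sum_i F i) k = \sum_i coef_mx (F i) k.
Proof.
apply/matrixP => i j; rewrite !mxE !summxE coef_sum.
by apply: eq_bigr => x _; rewrite mxE.
Qed.

Lemma coef_mxXn A d k : coef_mx ('X^d *: A) (d + k) = coef_mx A k.
Proof. by apply/matrixP => i j; rewrite !mxE coefXnM ltnNge leq_addr addKn. Qed.

End Degree.

(** In the convolution, an index [i] other than [a] has either [i > a] or [a + c - i > c], so only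
    one term survives. Both bounds may exceed the true degrees. *)
Lemma coef_mulD (R : nzRingType) (p r : {poly R}) (a c : nat) :
    (forall k, (a < k)%N -> p`_k = 0) -> (forall k, (c < k)%N -> r`_k = 0) ->
  (p * r)`_(a + c) = p`_a * r`_c.
Proof.
move=> pa rc; have ha : (a < (a + c).+1)%N by rewrite ltnS leq_addr.
rewrite coefM (bigD1 (Ordinal ha)) //= addKn big1 ?addr0 // => i.
rewrite -val_eqE /= neq_ltn => /orP[ia|ai]; last by rewrite pa ?mul0r.
by rewrite rc ?mulr0 //; lia.
Qed.

Lemma coef_mxM (K : fieldType) (m n p : nat) (A : 'M[{poly K}]_(m, n))
    (B : 'M[{poly K}]_(n, p)) (a c : nat) :
    (forall k, (a < k)%N -> coef_mx A k = 0) ->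
    (forall k, (c < k)%N -> coef_mx B k = 0) ->
  coef_mx (A *m B) (a + c) = coef_mx A a *m coef_mx B c.
Proof.
move=> Aa Bc; apply/matrixP => i j; rewrite !mxE coef_sum.
apply: eq_bigr => x _; rewrite !mxE; apply: coef_mulD => k ltk.
  by have /matrixP/(_ i x) := Aa k ltk; rewrite !mxE.
by have /matrixP/(_ x j) := Bc k ltk; rewrite !mxE.
Qed.

Lemma coef_comp_scaleX (R : comNzRingType) (p : {poly R}) (a : R) (k : nat) :
  (p \Po (a *: 'X))`_k = a ^+ k * p`_k.
Proof.
rewrite coef_comp_poly; case: (ltnP k (size p)) => [kp|pk]; last first.
  rewrite nth_default // mulr0 big1 // => i _; rewrite exprZn coefZ coefXn.
  by rewrite gtn_eqF ?mulr0 // (leq_trans (ltn_ord i)).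
rewrite (bigD1 (Ordinal kp)) //= exprZn coefZ coefXn eqxx mulr1 mulrC.
rewrite big1 ?addr0 // => i; rewrite -val_eqE /= eq_sym => /negPf ik.
by rewrite exprZn coefZ coefXn ik !mulr0.
Qed.

Section Shift.
Variables (K : fieldType) (q : K).

(** The action of sigma^j on polynomial matrices, kept inside K[t] so that coefficients can be
    compared. *)
Definition dilate_mx (m n j : nat) (y : 'M[{poly K}]_(m, n)) :=
  map_mx (fun p => p \Po (q ^+ j *: 'X)) y.

(** The factor is written [(q ^+ k) ^+ j] to match the evaluation of the head polynomial at
    [q ^+ k]. *)
Lemma coef_mx_dilate (m n j : nat) (y : 'M[{poly K}]_(m, n)) k :
  coef_mx (dilate_mx j y) k = (q ^+ k) ^+ j *: coef_mx y k.
Proof.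
by apply/matrixP => i x; rewrite !mxE coef_comp_scaleX exprAC.
Qed.

Lemma iter_qshift_poly (j : nat) (p : {poly K}) : q != 0 ->
  iter j (qshift q) p%:F = (p \Po (q ^+ j *: 'X))%:F.
Proof.
move=> q0; elim: j => [|j IH]; first by rewrite expr0 scale1r comp_polyXr.
rewrite iterS IH qshift_poly // -comp_polyA comp_polyZ comp_polyX scalerA.
by rewrite -exprSr.
Qed.

(** Once t^nu is cleared, both sides have entries in K[t], which embeds injectively into K(t). *)
Lemma is_solution_poly (m s nu : nat) (A : 'I_s.+1 -> 'M[{poly K}]_m)
    (b y : 'cV[{poly K}]_m) : q != 0 -> is_solution q A nu b y ->
  'X^nu *: (\sum_j A j *m dilate_mx j y) = b.
Proof.
move=> q0 /matrixP sol; apply/matrixP => i k; apply/eqP.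
have Xnu : ('X%:F : ratfun K) ^+ nu != 0.
  by rewrite expf_neq0 // tofrac_eq0 polyX_eq0.
rewrite -(@tofrac_eq _ _ _) mxE tofracM tofracXn summxE.
have := sol i k; rewrite !mxE summxE => /(congr1 ( *%R ('X%:F ^+ nu))).
rewrite mulrA divff // mul1r => <-; apply/eqP; congr (_ * _).
rewrite rmorph_sum; apply: eq_bigr => j _; rewrite !mxE rmorph_sum.
by apply: eq_bigr => x _; rewrite !mxE iter_qshift_poly // -tofracM.
Qed.

End Shift.

Lemma horner_t_head_poly (K : fieldType) (m s l : nat)
    (A : 'I_s.+1 -> 'M[{poly K}]_m) (x : K) :
  (t_head_poly l A).[x] = \det (\sum_(j < s.+1) x ^+ j *: coef_mx (A j) l).
Proof.
rewrite /t_head_poly -[LHS]/(horner_eval x _) -det_map_mx; congr (\det _).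
apply/matrixP => i k; rewrite mxE !summxE rmorph_sum.
by apply: eq_bigr => j _; rewrite !mxE /= /horner_eval hornerM hornerXn hornerC.
Qed.

Lemma det_mulmx_eq0 (K : fieldType) (m : nat) (M : 'M[K]_m) (v : 'cV[K]_m) :
  v != 0 -> M *m v = 0 -> \det M = 0.
Proof.
(* [det0P] speaks of row vectors in the left kernel, hence the transposition. *)
move=> v0 Mv; rewrite -det_tr; apply/eqP/det0P; exists v^T.
  by rewrite trmx_eq0.
by rewrite -trmx_mul Mv trmx0.
Qed.

(** Induction on the size: a root splits off a linear factor, which contributes a single point to
    the root set. *)
Lemma finite_roots (K : fieldType) (p : {poly K}) :
  p != 0 -> finite_set [set x | root p x].
Proof.
have [k] := ubnP (size p); elim: k p => // k IH p pk p0.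
have [[x px]|nx] := pselect (exists x, root p x); last first.
  by apply: (@sub_finite_set _ _ set0) => // x px; apply: nx; exists x.
have [r pE] := factor_theorem p x px; subst p.
have r0 : r != 0 by apply: contraNneq p0 => ->; rewrite mul0r.
apply: (@sub_finite_set _ _ ([set z | root r z] `|` [set x])%classic).
  by move=> z /=; rewrite rootM root_XsubC => /orP[|/eqP]; [left|right].
rewrite finite_setU; split; last exact: finite_set1.
by apply: IH => //; move: pk; rewrite size_Mmonic ?monicXsubC // size_XsubC addn2.
Qed.

(** For i < j, q^j - q^i = q^i (q^(j-i) - 1) is a product of nonzero factors. *)
Lemma expr_inj_nonroot (K : fieldType) (q : K) : q != 0 ->
  (forall k : nat, (0 < k)%N -> q ^+ k != 1) -> injective (GRing.exp q).
Proof.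
move=> q0 hq.
suff lt_neq i j : (i < j)%N -> q ^+ i != q ^+ j.
  by move=> i j eqij; case: (ltngtP i j) => // /lt_neq; rewrite eqij eqxx.
move=> ij; rewrite -(subnKC (ltnW ij)) exprD eq_sym -subr_eq0.
rewrite -{2}[q ^+ i]mulr1 -mulrBr mulf_neq0 ?expf_neq0 // subr_eq0 hq //.
by rewrite subn_gt0.
Qed.

Theorem theorem2p5 (K : fieldType) (charK : [pchar K] =i pred0)
  (q : K) (q0 : q != 0) (q_nonroot : forall k : nat, (0 < k)%N -> q ^+ k != 1)
  (m s nu l : nat) (A : 'I_s.+1 -> 'M[{poly K}]_m) (b : 'cV[{poly K}]_m)
  (A_full : full_left_row_rank q A)
  (l_max : \big[maxe/-oo%E]_(j < s.+1) deg_t (A j) = (l%:Z)%:E)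
  (head_regular : t_head_poly l A != 0) :
  let kappa := deg_t b in
  let candidate (n : nat) :=
    ((n%:Z)%:E <= kappa - (nu%:Z)%:E - (l%:Z)%:E)%E
    \/ root (t_head_poly l A) (q ^+ n) in
  (forall (n : nat) (y : 'cV[{poly K}]_m),
      is_solution q A nu b y -> deg_t y = (n%:Z)%:E -> candidate n)
  /\ finite_set [set n | candidate n].
Proof.
move=> kappa candidate; split=> [n y sol /deg_tP[yn0 y_gt]|]; last first.
  apply: (@sub_finite_set _ _
    ([set n : nat | ((n%:Z)%:E <= kappa - (nu%:Z)%:E - (l%:Z)%:E)%E]
     `|` [set n | root (t_head_poly l A) (q ^+ n)])%classic) => //.
  rewrite finite_setU; split; last first.
    apply: (finite_preimage (f := GRing.exp q)) (finite_roots head_regular).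
    by move=> i j _ _; exact: expr_inj_nonroot.
  have := deg_t_pinfty b; rewrite /kappa; case: (deg_t b) => [d||] // _.
    (* For an integer [kappa = d], condition 1 forces n <= d, hence n < |d| + 1. *)
    apply: (sub_finite_set _ (finite_II `|d|.+1)) => n /=.
    by rewrite -!EFinB lee_fin; lia.
  (* For [kappa = -oo] the bound in condition 1 is [-oo] too, and no n satisfies it. *)
  exact: (@sub_finite_set _ _ set0).
have A_gt j k : (l < k)%N -> coef_mx (A j) k = 0.
  apply: coef_mx_gt_deg; rewrite -l_max.
  exact: (le_bigmax_cond _ (fun j => deg_t (A j))).
pose M := \sum_(j < s.+1) (q ^+ n) ^+ j *: coef_mx (A j) l.
have bE : coef_mx b (nu + (l + n)) = M *m coef_mx y n.
  rewrite -{1}(is_solution_poly q0 sol) coef_mxXn coef_mx_sum mulmx_suml.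
  apply: eq_bigr => j _; rewrite (coef_mxM (A_gt j)) => [|k /y_gt yk].
    by rewrite coef_mx_dilate -scalemxAr -scalemxAl.
  by rewrite coef_mx_dilate yk scaler0.
have [b0|/deg_t_ge b_ge] := eqVneq (coef_mx b (nu + (l + n))) 0.
  right; rewrite /root horner_t_head_poly; apply/eqP.
  by apply: (det_mulmx_eq0 yn0); rewrite -bE.
(* The nonzero coefficient of [b] also rules out [kappa = -oo], so condition 1 becomes an inequality
   of integers. *)
left; rewrite /kappa; have := deg_t_pinfty b.
by case: (deg_t b) b_ge => [d||] //; rewrite -!EFinB !lee_fin; lia.
Qed.
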